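(* Let $\sigma$ be an adjacency-free permutation, and let $\pi$ be a permutation that contains an interval order-isomorphic to a symmetry of $1243$. Then $\mu[\sigma,\pi]=0$.
   Context: Permutations of length $n\ge 1$ are written in one-line notation $\pi=\pi_1\pi_2\cdots\pi_n$ (a bijection of $\{1,\dots,n\}$). A permutation $\sigma$ is contained in $\pi$, written $\sigma\le\pi$, if some subsequence of $\pi$ (not necessarily of consecutive entries) is order-isomorphic to $\sigma$. This makes the set of all permutations of all lengths a poset. The Möbius function of this poset is defined recursively by $\mu[\sigma,\pi]=0$ if $\sigma\not\le\pi$, $\mu[\sigma,\sigma]=1$, and $\mu[\sigma,\pi]=-\sum_{\sigma\le\tau<\pi}\mu[\sigma,\tau]$ if $\sigma<\pi$. An interval of a permutation $\pi$ is a non-empty set of contiguous indices $i,i+1,\dots,j$ such that the set of values $\{\pi_i,\dots,\pi_j\}$ is also a set of contiguous integers; it is order-isomorphic to a permutation $\alpha$ if the sequence $\pi_i\cdots\pi_j$ is order-isomorphic to $\alpha$. An adjacency is an interval of length two, i.e. an index pair $i,i+1$ with $|\pi_{i+1}-\pi_i|=1$. A permutation is adjacency-free if it contains no adjacencies. The symmetries of a permutation are the permutations obtained from it by compositions of reversal, complement and inverse; the symmetries of $1243$ are $1243$, $2134$, $3421$ and $4312$. *)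

(* Defs.v *)
From HB Require Import structures.
From mathcomp Require Import all_boot all_order all_fingroup all_algebra.
From mathcomp Require Import zify.

Set Implicit Arguments.
Unset Strict Implicit.
Unset Printing Implicit Defensive.

Import Order.TTheory GRing.Theory Num.Theory.

(* The lengths are n.+1, so that the empty permutation is excluded; indices and
   values are numbered from 0. *)
Definition permutation := {n : nat & {perm 'I_n.+1}}.

HB.instance Definition _ := Countable.on permutation.

Definition mkp (n : nat) (s : {perm 'I_n.+1}) : permutation :=
  Tagged (fun n => {perm 'I_n.+1}) s.

Definition plength (p : permutation) : nat := (tag p).+1.

(* f lists, in increasing order, the indices of a subsequence of p that is
   order-isomorphic to s. *)
Definition occurrence (s p : permutation)
    (f : {ffun 'I_(plength s) -> 'I_(plength p)}) : bool :=
  [forall i : 'I_(plength s), forall j : 'I_(plength s),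
     (i < j) ==> (f i < f j)] &&
  [forall i, forall j,
     (tagged s i < tagged s j) == (tagged p (f i) < tagged p (f j))].

Definition contained (s p : permutation) : bool :=
  [exists f, @occurrence s p f].

Lemma containedP (s p : permutation) :
  reflect (exists f : 'I_(plength s) -> 'I_(plength p),
    (forall i j : 'I_(plength s), i < j -> f i < f j) /\
    (forall i j, (tagged s i < tagged s j) = (tagged p (f i) < tagged p (f j))))
    (contained s p).
Proof.
apply: (iffP existsP) => [[f /andP[]] | [f [H1 H2]]].
  by move=> /'forall_'forall_implyP H1 /'forall_'forall_eqP H2; exists f.
exists (finfun f); apply/andP; split.
  by apply/'forall_'forall_implyP => i j ij; rewrite !ffunE H1.
by apply/'forall_'forall_eqP => i j; rewrite !ffunE H2.
Qed.

Lemma contained_refl : reflexive contained.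
Proof. by move=> p; apply/containedP; exists id. Qed.

Lemma contained_trans : transitive contained.
Proof.
move=> q p r /containedP[f [f1 f2]] /containedP[g [g1 g2]].
apply/containedP; exists (g \o f); split => i j /=; first by move=> /f1/g1.
by rewrite f2 g2.
Qed.

Lemma mono_leq m n (f : 'I_m -> 'I_n) :
  (forall i j : 'I_m, i < j -> f i < f j) -> forall i : 'I_m, i <= f i.
Proof.
move=> fi [i im] /=; elim: i im => // i IH im.
by apply: leq_ltn_trans (IH (ltnW im)) _; apply: fi.
Qed.

Lemma contained_length (s p : permutation) :
  contained s p -> plength s <= plength p.
Proof.
move=> /containedP[f [/mono_leq H _]].
by have := H ord_max; move/leq_ltn_trans; apply.
Qed.

Lemma mono_id n (f : 'I_n -> 'I_n) :
  (forall i j : 'I_n, i < j -> f i < f j) -> f =1 id.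
Proof.
case: n f => [|n] f fi; first by case.
suff H d : forall i : 'I_n.+1, i + d = n -> f i = i.
  by move=> i; apply: (H (n - i)); rewrite subnKC // -ltnS.
elim: d => [|d IH] i E; apply/val_inj/eqP; rewrite eqn_leq (mono_leq fi) andbT.
  by rewrite addn0 in E; rewrite /= E -ltnS.
have lt : i.+1 < n.+1 by have := leq_addr d i.+1; rewrite addSnnS E.
have := fi i (Ordinal lt) (ltnSn _).
by rewrite (IH (Ordinal lt)) /= ?addSnnS // ltnS.
Qed.

Lemma perm_order_inj n (s t : {perm 'I_n}) :
  (forall i j, (s i < s j) = (t i < t j)) -> s = t.
Proof.
move=> H; suff E : (s^-1 * t)%g =1 id.
  by apply/permP => i; rewrite -{2}(permK s i) -(permM s^-1) E.
by apply: mono_id => i j ij; rewrite !permM -H !permKV.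
Qed.

Lemma contained_eq (s p : permutation) :
  contained s p -> plength s = plength p -> s = p.
Proof.
case: s p => [m s] [n p] /containedP[f [f1 f2]] [/= E].
case: n / E p f f1 f2 => p f f1 f2; congr existT.
by apply: perm_order_inj => i j; rewrite f2 !(mono_id f1).
Qed.

Lemma contained_anti : antisymmetric contained.
Proof.
move=> s p /andP[sp ps]; apply: contained_eq => //.
by apply/anti_leq; rewrite !contained_length.
Qed.

Fact permutation_display : Order.disp_t. Proof. exact: Order.Disp tt tt. Qed.

HB.instance Definition _ := Order.Le_isPOrder.Build permutation_display
  permutation contained_refl contained_anti contained_trans.

(* The double sum ranges over the permutations of length at most plength p, so
   it contains every t < p, by contained_length. The recursion is bounded by k;
   its value does not depend on k once plength p <= k (mobius_rec_fuel), and
   mobius satisfies the unbounded recursion (mobius_lt). *)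
Fixpoint mobius_rec (k : nat) (s p : permutation) : int :=
  if s == p then 1%R
  else if ~~ (s <= p)%O then 0%R
  else if k is k'.+1 then
    (- \sum_(n < plength p) \sum_(t : {perm 'I_n.+1} |
          (s <= mkp t)%O && (mkp t < p)%O) mobius_rec k' s (mkp t))%R
  else 0%R.

Definition mobius (s p : permutation) : int := mobius_rec (plength p) s p.

Lemma lt_plength (s p : permutation) : (s < p)%O -> plength s < plength p.
Proof.
rewrite lt_neqAle => /andP[ne le]; rewrite ltn_neqAle contained_length // andbT.
by apply: contraNneq ne => /(contained_eq le) ->.
Qed.

Lemma mobius_rec_fuel k1 k2 s p : plength p <= k1 -> plength p <= k2 ->
  mobius_rec k1 s p = mobius_rec k2 s p.
Proof.
elim: k1 k2 p => [|k1 IH] [|k2] p //= h1 h2.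
case: ifP => // _; case: ifP => // _; congr (- _)%R.
apply: eq_bigr => n _; apply: eq_bigr => t /andP[_ /lt_plength lt].
by apply: IH; rewrite -ltnS; apply: leq_trans lt _.
Qed.

Lemma mobius_nle s p : ~~ (s <= p)%O -> mobius s p = 0%R.
Proof.
by move=> nle; rewrite /mobius /= nle; case: eqP nle => // ->; rewrite lexx.
Qed.

Lemma mobius_refl s : mobius s s = 1%R.
Proof. by rewrite /mobius /= eqxx. Qed.

Lemma mobius_lt s p : (s < p)%O ->
  mobius s p = (- \sum_(n < plength p) \sum_(t : {perm 'I_n.+1} |
                     (s <= mkp t)%O && (mkp t < p)%O) mobius s (mkp t))%R.
Proof.
move=> lt; rewrite {1}/mobius /= (lt_eqF lt) (ltW lt) /=; congr (- _)%R.
apply: eq_bigr => n _; apply: eq_bigr => t /andP[_ /lt_plength tp].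
exact: mobius_rec_fuel.
Qed.

Definition contiguous (n : nat) (i j : 'I_n) : {set 'I_n} :=
  [set k : 'I_n | i <= k <= j].

Definition interval (p : permutation) (i j : 'I_(plength p)) : bool :=
  (i <= j) &&
  [exists a, exists b, tagged p @: contiguous i j == contiguous a b].

(* The entries of p at the indices i, ..., j form an occurrence of a. *)
Definition interval_iso (a p : permutation) (i j : 'I_(plength p)) : bool :=
  [exists f, @occurrence a p f &&
     ([set f k | k : 'I_(plength a)] == contiguous i j)].

Definition has_interval (a p : permutation) : bool :=
  [exists i, exists j, @interval p i j && @interval_iso a p i j].

Definition adjacency (p : permutation) (i j : 'I_(plength p)) : bool :=
  (j == i.+1 :> nat) && interval i j.

Definition adjacency_free (p : permutation) : bool :=
  ~~ [exists i, exists j, @adjacency p i j].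

Lemma adjacencyE (p : permutation) (i j : 'I_(plength p)) :
  adjacency i j = (j == i.+1 :> nat) &&
    ((tagged p j == (tagged p i).+1 :> nat) ||
     (tagged p i == (tagged p j).+1 :> nat)).
Proof.
case: p i j => [n s]; rewrite /adjacency /interval /plength /= => i j.
case: eqP => //= ij; rewrite ij leqnSn /=.
have -> : contiguous i j = [set i; j].
  by apply/setP => k; rewrite !inE -!val_eqE /=; lia.
rewrite imsetU !imset_set1.
have : s i != s j :> nat.
  by rewrite val_eqE (inj_eq perm_inj) -val_eqE /=; lia.
move: (s i) (s j) => x y xy.
apply/existsP/idP => [[a /existsP[b /eqP/setP E]] | xyE].
  have := (E x, E y, E a, E b); rewrite !inE !eqxx orbT -!val_eqE /=.
  move=> [[[Ex Ey] Ea] Eb]; apply: contraT => nadj.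
  have lt : a.+1 < n.+1 by have := ltn_ord b; lia.
  by have := E (Ordinal lt); rewrite !inE -!val_eqE /=; lia.
by case/orP: xyE => /eqP E; [exists x; apply/existsP; exists y |
  exists y; apply/existsP; exists x]; apply/eqP/setP => k;
  rewrite !inE -!val_eqE /=; lia.
Qed.

Definition reversal (n : nat) (s : {perm 'I_n}) : {perm 'I_n} :=
  (perm (@rev_ord_inj n) * s)%g.

Definition complement (n : nat) (s : {perm 'I_n}) : {perm 'I_n} :=
  (s * perm (@rev_ord_inj n))%g.

Inductive symmetry (n : nat) (s : {perm 'I_n}) : {perm 'I_n} -> Prop :=
| SymId : symmetry s s
| SymReversal t : symmetry s t -> symmetry s (reversal t)
| SymComplement t : symmetry s t -> symmetry s (complement t)
| SymInverse t : symmetry s t -> symmetry s (t^-1)%g.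

Definition oneline (n : nat) (s : {perm 'I_n}) : seq nat :=
  [seq (s i : nat).+1 | i <- enum 'I_n].

(* 1243, the permutation exchanging the last two indices; see oneline_1243. *)
Definition perm1243 : {perm 'I_4} := tperm (inord 2) (inord 3).

Lemma oneline_inj n : injective (@oneline n).
Proof.
move=> s t /eq_in_map E; apply/permP => i; apply/val_inj/succn_inj.
by apply: E; rewrite mem_enum.
Qed.

Lemma oneline_1243 : oneline perm1243 = [:: 1; 2; 4; 3].
Proof.
by rewrite /oneline !enum_ordSl enum_ord0 /= !permE /= -!val_eqE /= !inordK.
Qed.

Lemma nth_oneline n (s : {perm 'I_n}) x (i : 'I_n) :
  nth x (oneline s) i = (s i).+1.
Proof. by rewrite (nth_map i) ?size_enum_ord // nth_ord_enum. Qed.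

Lemma size_oneline n (s : {perm 'I_n}) : size (oneline s) = n.
Proof. by rewrite size_map size_enum_ord. Qed.

Lemma oneline_reversal n (s : {perm 'I_n}) :
  oneline (reversal s) = rev (oneline s).
Proof.
apply: (@eq_from_nth _ 0); rewrite ?size_rev !size_oneline // => i lt.
rewrite nth_rev size_oneline //.
rewrite (nth_oneline _ _ (Ordinal lt)) permM permE.
by rewrite (nth_oneline _ _ (rev_ord (Ordinal lt))).
Qed.

Lemma oneline_complement n (s : {perm 'I_n}) :
  oneline (complement s) = [seq n.+1 - x | x <- oneline s].
Proof.
rewrite /oneline -map_comp; apply: eq_map => i /=.
by rewrite permM permE /= subSS subnSK.
Qed.

Lemma oneline_inverse n (s : {perm 'I_n}) :
  oneline (s^-1)%g = [seq (index x (oneline s)).+1 | x <- iota 1 n].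
Proof.
apply: (@eq_from_nth _ 0); rewrite !(size_oneline, size_map) ?size_iota // => i lt.
rewrite (nth_oneline _ _ (Ordinal lt)) (nth_map 0) ?size_iota // nth_iota // add1n.
congr _.+1; have -> : i.+1 = nth 0 (oneline s) ((s^-1)%g (Ordinal lt)).
  by rewrite nth_oneline permKV.
rewrite index_uniq ?size_oneline // map_inj_uniq ?enum_uniq //.
by move=> x y [] /val_inj/perm_inj.
Qed.

Lemma symmetry1243P (t : {perm 'I_4}) :
  symmetry perm1243 t <->
  oneline t \in [:: [:: 1; 2; 4; 3]; [:: 2; 1; 3; 4];
                   [:: 3; 4; 2; 1]; [:: 4; 3; 1; 2]].
Proof.
split=> [|].
  elim=> [|{}t _|{}t _|{}t _]; first by rewrite oneline_1243.
  - by rewrite oneline_reversal !inE => /or4P[] /eqP ->.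
  - by rewrite oneline_complement !inE => /or4P[] /eqP ->.
  - by rewrite oneline_inverse !inE => /or4P[] /eqP ->.
have S0 := SymId perm1243.
have S1 := SymReversal S0; have S2 := SymComplement S0.
have S3 := SymReversal S2.
rewrite !inE => /or4P[] /eqP E.
- by rewrite (_ : t = perm1243) //; apply: oneline_inj; rewrite E oneline_1243.
- rewrite (_ : t = reversal (complement perm1243)) //; apply: oneline_inj.
  by rewrite E oneline_reversal oneline_complement oneline_1243.
- rewrite (_ : t = reversal perm1243) //; apply: oneline_inj.
  by rewrite E oneline_reversal oneline_1243.
- rewrite (_ : t = complement perm1243) //; apply: oneline_inj.
  by rewrite E oneline_complement oneline_1243.
Qed.

(* Main.v *)
Require Import Defs.
From mathcomp Require Import all_boot all_order all_fingroup all_algebra.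
From mathcomp Require Import zify.

(* Let b be an entry of pi whose deletion leaves an adjacency, and let q be the
   permutation left. As q <> sigma, the sum of mu[sigma, t] over t <= q is 0, so
   mu[sigma, pi] = 0 as soon as mu[sigma, t] = 0 for all t < pi with t </= q.
   - In an interval 123, take b = 2: in an embedding that misses 1 or 3 the image
     2 can be replaced by the missing entry, so any t </= q embeds with image
     containing the whole interval and inherits it; conclude by induction.
   - In an interval 1243, take b = 2: a t </= q likewise either inherits the
     interval 1243, or embeds avoiding 4. In the latter case it inherits the
     interval 123 left by deleting 4, for otherwise it would embed avoiding 4
     and one of 1, 2, 3, hence also avoiding 2. *)

Set Implicit Arguments.
Unset Strict Implicit.
Unset Printing Implicit Defensive.

Import Order.TTheory GRing.Theory.

(** * Embeddings and restriction to a set of entries *)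

Definition embedding (s p : permutation)
    (f : 'I_(plength s) -> 'I_(plength p)) : Prop :=
  (forall i j : 'I_(plength s), i < j -> f i < f j) /\
  (forall i j, (tagged s i < tagged s j) = (tagged p (f i) < tagged p (f j))).

Lemma embedding_lt (s p : permutation) f (i j : 'I_(plength s)) :
  @embedding s p f -> (f i < f j) = (i < j).
Proof.
move=> [f1 _]; case: (ltngtP i j) => [/f1 //|/f1|/val_inj->]; last exact: ltnn.
by move=> lt; apply/negbTE; rewrite -leqNgt ltnW.
Qed.

Lemma embedding_inj (s p : permutation) f : @embedding s p f -> injective f.
Proof.
move=> fe i j E; apply/ord_inj/eqP; rewrite eqn_leq leqNgt (leqNgt j).
by rewrite -(embedding_lt i j fe) -(embedding_lt j i fe) E ltnn.
Qed.

Lemma embedding_comp (s q p : permutation) g f :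
  @embedding s q g -> @embedding q p f -> embedding (f \o g).
Proof.
move=> [g1 g2] [f1 f2]; split=> i j /=; first by move/g1/f1.
by rewrite (g2 i j) (f2 (g i) (g j)).
Qed.

Lemma increasing_enumeration m n (A : {set 'I_m}) : #|A| = n.+1 ->
  exists e : 'I_n.+1 -> 'I_m,
    (forall i j : 'I_n.+1, (e i < e j) = (i < j)) /\
    (forall x, x \in A <-> exists k, e k = x).
Proof.
move=> cA.
have [x0 _] : {x0 | x0 \in A} by apply/sigW/card_gt0P; rewrite cA.
have sz : size (enum A) = n.+1 by rewrite -cardE.
have so : sorted (fun x y : 'I_m => x < y) (enum A).
  rewrite /enum_mem -enumT.
  apply: sorted_filter; first by move=> y x z; apply: ltn_trans.
  have := iota_ltn_sorted 0 m.
  by rewrite -val_enum_ord sorted_map.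
pose e (k : 'I_n.+1) := nth x0 (enum A) k.
have e1 (i j : 'I_n.+1) : i < j -> e i < e j.
  move=> ij; apply: (sorted_ltn_nth _ x0 so); rewrite ?inE ?sz //.
  by move=> y x z; apply: ltn_trans.
exists e; split=> [i j|x].
  case: (ltngtP i j) => [/e1 //|/e1|/val_inj->]; last exact: ltnn.
  by move=> lt; apply/negbTE; rewrite -leqNgt ltnW.
split=> [xA|[k <-]]; last by rewrite -mem_enum mem_nth ?sz.
have lt : index x (enum A) < n.+1 by rewrite -sz index_mem mem_enum.
by exists (Ordinal lt); rewrite /e /= nth_index // mem_enum.
Qed.

(** The permutation [q] is the pattern of [p] on [A]: one increasing enumeration lists the indices
    in [A], another their values, and [t k] below is the rank of the [k]-th value. *)
Lemma restriction (p : permutation) (A : {set 'I_(plength p)}) :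
  A != set0 -> exists q f, @embedding q p f /\
    (forall x, x \in A <-> exists k, f k = x).
Proof.
case: p A => [m s] A; rewrite /plength /= in A *; rewrite -card_gt0 => A0.
have [n cA] : exists n, #|A| = n.+1 by exists #|A|.-1; rewrite prednK.
have cB : #|s @: A| = n.+1 by rewrite card_imset //; apply: perm_inj.
have [e [e1 e2]] := increasing_enumeration cA.
have [v [v1 v2]] := increasing_enumeration cB.
have E k : exists l, v l == s (e k).
  have [l <-] : exists l, v l = s (e k) by apply/v2/imset_f/e2; exists k.
  by exists l.
pose t k := xchoose (E k).
have tE k : v (t k) = s (e k) by apply/eqP/(xchooseP (E k)).
have inj : injective t.
  move=> i j ij; have : s (e i) = s (e j) by rewrite -!tE ij.
  move/perm_inj => eij; apply/ord_inj/eqP.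
  by rewrite eqn_leq leqNgt (leqNgt j) -e1 -(e1 i) eij ltnn.
exists (mkp (perm inj)), e; split=> //; split=> [i j|i j]; first by rewrite e1.
by rewrite /= !permE -v1 !tE.
Qed.

(** An embedding into [p] with image in [A] factors through [f], a bijection onto [A] that preserves
    and reflects both orders. With [A] the complement of one entry, this describes the permutations
    below the deletion. *)
Lemma restriction_le (p q s : permutation) (A : {set 'I_(plength p)}) f :
  @embedding q p f -> (forall x, x \in A <-> exists k, f k = x) ->
  (s <= q)%O <-> exists g, @embedding s p g /\ forall i, g i \in A.
Proof.
move=> fe fA; split=> [/containedP[h he]|[g [ge gA]]].
  exists (f \o h); split; first exact: (embedding_comp he fe).
  by move=> i; apply/fA; exists (h i).
have E i : exists k, f k == g i.
  by have /fA[k <-] := gA i; exists k.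
pose h i := xchoose (E i).
have hE i : f (h i) = g i by apply/eqP/(xchooseP (E i)).
apply/containedP; exists h; split=> i j.
  by rewrite -(embedding_lt i j ge) -!hE (embedding_lt (h i) (h j) fe).
by rewrite (proj2 ge i j) (proj2 fe (h i) (h j)) !hE.
Qed.

(** * Twins, a form of adjacency relative to a set of entries *)

(* If A consists of all indices, distinct x and y are twins iff they form an
   adjacency. *)
Definition twins (p : permutation) (A : {pred 'I_(plength p)})
    (x y : 'I_(plength p)) : Prop :=
  forall z, z \in A -> z != x -> z != y ->
    ((z < x) = (z < y)) /\
    ((tagged p z < tagged p x) = (tagged p z < tagged p y)).

Lemma twins_sym p A x y : @twins p A x y -> @twins p A y x.
Proof. by move=> t z zA zy zx; have [-> ->] := t z zA zx zy. Qed.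

Lemma twins_sub p (A B : {pred 'I_(plength p)}) x y :
  {subset B <= A} -> twins A x y -> twins B x y.
Proof. by move=> BA t z /BA zA; apply: t. Qed.

(** The middle entry [y] could itself separate [x] from [z]; once it is outside [A], every remaining
    entry can be compared with [x], [y] and [z] in turn. *)
Lemma twins_trans p A x y z : y \notin A ->
  @twins p A x y -> @twins p A y z -> @twins p A x z.
Proof.
move=> yA xy yz w wA wx wz.
have wy : w != y by apply: contraNneq yA => <-.
have [-> ->] := xy w wA wx wy.
exact: yz.
Qed.

(** If [x] and [y] were not neighbours in index or in value, the entry next to one of them on the
    side of the other would separate them. *)
Lemma twins_adjacency p (x y : 'I_(plength p)) :
  x != y -> twins predT x y -> ~~ adjacency_free p.
Proof.
wlog xy : x y / x < y => [H ne t|ne t].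
  case: (ltngtP x y) => [xy|yx|/ord_inj E]; last by rewrite E eqxx in ne.
    exact: H t.
  by apply: H yx _ (twins_sym t); rewrite eq_sym.
rewrite negbK; apply/existsP; exists x; apply/existsP; exists y.
rewrite adjacencyE; apply/andP; split.
  apply: contraT => yE.
  have lt : x.+1 < plength p by have := ltn_ord y; lia.
  by have [||] := t (Ordinal lt) isT; rewrite -?val_eqE /=; lia.
have ne' : tagged p x != tagged p y :> nat.
  by apply: contra ne => /eqP/val_inj/perm_inj ->.
apply: contraT => nadj.
have lt : (minn (tagged p x) (tagged p y)).+1 < (tag p).+1.
  by have := ltn_ord (tagged p x); have := ltn_ord (tagged p y); lia.
pose z : 'I_(plength p) := ((tagged p)^-1)%g (Ordinal lt).
have zE : tagged p z = (minn (tagged p x) (tagged p y)).+1 :> nat.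
  by rewrite permKV.
have zx : z != x by apply/negP => /eqP E; rewrite E in zE; lia.
have zy : z != y by apply/negP => /eqP E; rewrite E in zE; lia.
by have [_] := t z isT zx zy; rewrite zE; lia.
Qed.

Lemma embedding_twins (s p : permutation) f (A : {pred 'I_(plength p)})
    (B : {pred 'I_(plength s)}) i j :
  @embedding s p f -> (forall k, k \in B -> f k \in A) ->
  twins A (f i) (f j) -> twins B i j.
Proof.
move=> fe BA t k kB ki kj.
rewrite -(embedding_lt k i fe) -(embedding_lt k j fe).
rewrite (proj2 fe k i) (proj2 fe k j).
by apply: t; rewrite ?BA ?(inj_eq (embedding_inj fe)).
Qed.

(** Redirecting to [y] the index sent to [x], if there is one, changes no comparison with the other
    image entries, because [x] and [y] are twins. An embedding that misses [y] thus becomes one that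
    misses [x]. *)
Lemma embedding_swap (s p : permutation) f (A : {set 'I_(plength p)}) x y :
  @embedding s p f -> (forall i, f i \in A) -> y \notin A -> twins A x y ->
  exists g, @embedding s p g /\ forall i, g i \in y |: (A :\ x).
Proof.
move=> fe fA yA t.
have fy i : f i != y by apply: contraNneq yA => <-.
pose g i := if f i == x then y else f i.
have tx i : f i != x -> ((f i < x) = (f i < y)) /\
    ((tagged p (f i) < tagged p x) = (tagged p (f i) < tagged p y)).
  by move=> ne; apply: t.
(* As [f i] differs from [x] and [y] in index and in value, the reversed comparisons are the
   negations of those in [tx]. *)
have tx' i : f i != x -> ((x < f i) = (y < f i)) /\
    ((tagged p x < tagged p (f i)) = (tagged p y < tagged p (f i))).
  move=> ne; have [lt1 lt2] := tx i ne.
  have n1 : f i != x :> nat by [].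
  have n2 : f i != y :> nat by rewrite val_eqE.
  have n3 : tagged p (f i) != tagged p x :> nat.
    by rewrite val_eqE (inj_eq perm_inj).
  have n4 : tagged p (f i) != tagged p y :> nat.
    by rewrite val_eqE (inj_eq perm_inj).
  by lia.
exists g; split; last first.
  move=> i; rewrite /g; case: ifP => [_|/negbT ne].
    by rewrite !inE eqxx.
  by rewrite !inE ne fA orbT.
split=> i j.
  rewrite -(embedding_lt i j fe) /g.
  case: ifP => [/eqP E|/negbT ni]; case: ifP => [/eqP E'|/negbT nj] //.
  - by rewrite E E' ltnn.
  - by rewrite E (tx' j nj).1.
  - by rewrite E' (tx i ni).1.
rewrite (proj2 fe i j) /g.
case: ifP => [/eqP E|/negbT ni]; case: ifP => [/eqP E'|/negbT nj] //.
- by rewrite E E' !ltnn.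
- by rewrite E (tx' j nj).2.
- by rewrite E' (tx i ni).2.
Qed.

(** * Sums over permutations of bounded length *)

(** Order ideals enter as factors 0 or 1 in [F], so that sums over different ideals share one range
    and can be compared term by term. *)
Definition total (N : nat) (F : permutation -> int) : int :=
  (\sum_(n < N) \sum_(t : {perm 'I_n.+1}) F (mkp t))%R.

Lemma eq_total N F G : F =1 G -> total N F = total N G.
Proof. by move=> E; apply: eq_bigr => n _; apply: eq_bigr => t _; apply: E. Qed.

Lemma totalD N F G : total N (fun t => F t + G t)%R = (total N F + total N G)%R.
Proof.
by rewrite /total -big_split; apply: eq_bigr => n _; rewrite -big_split.
Qed.

Lemma total0 N F : F =1 (fun=> 0%R) -> total N F = 0%R.
Proof.
by move=> E; apply: big1 => n _; apply: big1 => t _; apply: E.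
Qed.

Lemma total1 N q (c : int) : plength q <= N ->
  total N (fun t => c * (t == q)%:R)%R = c.
Proof.
case: q => [m s] mN; rewrite /total (bigD1 (Ordinal mN)) //= (bigD1 s) //=.
rewrite eqxx mulr1 !big1 ?addr0 //.
  move=> n nm; apply: big1 => t _; rewrite (negbTE (_ : mkp t != _)) ?mulr0 //.
  by apply: contra nm => /eqP/(congr1 (@tag _ _)) /= E; rewrite -val_eqE /= E.
move=> t ts; rewrite (negbTE (_ : mkp t != _)) ?mulr0 //.
by apply: contra ts; rewrite -tag_eqE /tag_eq /= eqxx /= tagged_asE.
Qed.

Lemma total_widen M N F : M <= N -> (forall t, M < plength t -> F t = 0%R) ->
  total M F = total N F.
Proof.
move=> MN F0.
rewrite /total.
rewrite (big_ord_widen N (fun n => \sum_(t : {perm 'I_n.+1}) F (mkp t))%R) //.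
rewrite big_mkcond; apply: eq_bigr => n _; case: ltnP => // Mn.
by rewrite big1 // => t _; apply: F0.
Qed.

(** The condition that [s] is below [t] disappears from the recursion because [mobius s t] is 0
    otherwise. *)
Lemma mobius_total s p N : (s < p)%O -> plength p <= N ->
  mobius s p = (- total N (fun t => mobius s t * (t < p)%O%:R))%R.
Proof.
move=> sp pN; rewrite (mobius_lt sp) -(total_widen pN); last first.
  move=> t pt; rewrite (negbTE (_ : ~~ (t < p)%O)) ?mulr0 //.
  by apply: contraL pt => /lt_plength; rewrite -leqNgt => /ltnW.
congr (- _)%R; apply: eq_bigr => n _; rewrite big_mkcond; apply: eq_bigr => t _.
case: (boolP (s <= mkp t)%O) => [_|/mobius_nle ->]; last by rewrite mul0r.
by case: (_ < _)%O; rewrite ?mulr1 ?mulr0.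
Qed.

(** This is the inversion identity of the incidence algebra. For [s < q] it is the recursion with
    the term [t = q] moved to the other side. *)
Lemma total_mobius s q N : plength q <= N ->
  total N (fun t => mobius s t * (t <= q)%O%:R)%R = (s == q)%:R%R.
Proof.
move=> qN; have [->|sq] := eqVneq s q.
  rewrite -[RHS](total1 1%R qN); apply: eq_total => t.
  have [->|tq] := eqVneq t q; first by rewrite lexx mobius_refl.
  case: (boolP (t <= q)%O) => [le|_]; last by rewrite !mulr0.
  rewrite mobius_nle ?mul0r ?mulr0 //.
  by apply: contra tq => qt; rewrite eq_le le.
case: (boolP (s <= q)%O) => [le|nle]; last first.
  apply: total0 => t; case: (boolP (t <= q)%O) => [tq|_]; last by rewrite mulr0.
  rewrite mobius_nle ?mul0r //; apply: contra nle => st.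
  exact: le_trans st tq.
have lt : (s < q)%O by rewrite lt_neqAle sq.
transitivity (total N (fun t => mobius s q * (t == q)%:R +
                                mobius s t * (t < q)%O%:R)%R).
  apply: eq_total => t; rewrite le_eqVlt.
  have [->|_] := eqVneq t q; first by rewrite ltxx mulr0 addr0.
  by rewrite mulr0 add0r.
by rewrite totalD total1 // (mobius_total lt qN) addNr.
Qed.

(** * Deletion of one entry *)

Lemma embedding_hits (s p : permutation)
    (f : 'I_(plength s) -> 'I_(plength p)) x :
  (exists i, f i = x) \/ (forall i, f i \in ~: [set x]).
Proof.
case: (pickP (fun i => f i == x)) => [i /eqP|no]; first by left; exists i.
by right=> i; rewrite !inE no.
Qed.

(* The permutation obtained by deleting b is not sigma, having an adjacency, so
   the values of the Möbius function below it sum to 0. *)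
Lemma mobius_eq0_deletion s p b x y :
  adjacency_free s -> ~~ adjacency_free p ->
  x != b -> y != b -> x != y -> @twins p (predC1 b) x y ->
  (forall t, (t < p)%O -> mobius s t = 0%R \/
     exists g, @embedding t p g /\ forall i, g i \in ~: [set b]) ->
  mobius s p = 0%R.
Proof.
move=> sf pf xb yb xy tw H.
case: (boolP (s <= p)%O) => [le|]; last exact: mobius_nle.
have lt : (s < p)%O.
  by rewrite lt_neqAle le andbT; apply: contraNneq pf => <-.
have [|q [f [fe fA]]] := @restriction p (~: [set b]).
  by apply/set0Pn; exists x; rewrite !inE.
have qle := restriction_le _ fe fA.
have qp : (q < p)%O.
  rewrite lt_leAnge; apply/andP; split; first by apply/containedP; exists f.
  (* An embedding of [p] into itself is the identity, so it cannot avoid [b]. *)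
  apply/negP => /(qle p)[g [[g1 _] gA]].
  by have := gA b; rewrite (mono_id g1) !inE eqxx.
have sq : s != q.
  apply: contraTneq sf => ->.
  have [x' xE] : exists x', f x' = x by apply/fA; rewrite !inE.
  have [y' yE] : exists y', f y' = y by apply/fA; rewrite !inE.
  apply: (@twins_adjacency q x' y').
    by apply: contraNneq xy => E; rewrite -xE -yE E.
  apply: (embedding_twins fe _ (A := predC1 b)); last by rewrite xE yE.
  move=> k _; have : f k \in ~: [set b] by apply/fA; exists k.
  by rewrite !inE.
rewrite (mobius_total lt (leqnn _)).
have := total_mobius s (ltnW (lt_plength qp)); rewrite (negbTE sq) => E.
(* The zero is written as the sum over [t <= q]. It then agrees term by term with the sum over
   [t < p]: where the two conditions differ, [mobius s t] is 0. *)
rewrite -[RHS]oppr0; congr (- _)%R; rewrite -[RHS]E; apply: eq_total => t.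
case: (boolP (t < p)%O) => [tp|ntp].
  by have [->|/qle ->] := H t tp; rewrite ?mul0r.
case: (boolP (t <= q)%O) => // tq.
by rewrite (le_lt_trans tq qp) in ntp.
Qed.

(** * Intervals 123 and 1243 up to symmetry *)

(** This is an interval 123 or 321 with middle entry [y], since [x] and [z] are distinct neighbours
    of [y] both in index and in value. *)
Definition triple_adjacency (p : permutation) : Prop :=
  exists x y z : 'I_(plength p), uniq [:: x; y; z] /\
    twins predT x y /\ twins predT y z.

Lemma mobius_triple_adjacency s p :
  adjacency_free s -> triple_adjacency p -> mobius s p = 0%R.
Proof.
move=> sf; have [n] := ubnP (plength p); elim: n p => // n IH p pn.
move=> [x [y [z [u [xy yz]]]]].
have /and3P[xny xnz ynz] : [&& x != y, x != z & y != z].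
  by move: u; rewrite /= !inE negb_or andbT -andbA.
apply: (mobius_eq0_deletion (b := y) (x := x) (y := z)) => //.
- exact: twins_adjacency xny xy.
- by rewrite eq_sym.
- apply: (@twins_trans _ _ _ y); first by rewrite !inE eqxx.
    exact: twins_sub xy.
  exact: twins_sub yz.
move=> t tp; have [g ge] : exists g, @embedding t p g.
  exact/containedP/(ltW tp).
have [[j jE]|gA] := embedding_hits g y; last by right; exists g.
(* If [x] or [z] is missed, a swap with [y] gives an embedding that avoids [y]. *)
have [[i iE]|gA] := embedding_hits g x; last first.
  right; have [||h [he hA]] := embedding_swap (x := y) (y := x) ge gA.
  - by rewrite !inE eqxx.
  - exact: twins_sub (twins_sym xy).
  exists h; split=> // k; have := hA k.
  by rewrite !inE => /orP[/eqP -> //|/andP[]].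
have [[k kE]|gA] := embedding_hits g z; last first.
  right; have [||h [he hA]] := embedding_swap (x := y) (y := z) ge gA.
  - by rewrite !inE eqxx.
  - exact: twins_sub yz.
  exists h; split=> // l; have := hA l.
  by rewrite !inE => /orP[/eqP ->|/andP[] //]; rewrite eq_sym.
left; apply: IH; first exact: leq_trans (lt_plength tp) _.
exists i, j, k; split.
  by apply: (@map_uniq _ _ g); rewrite /= iE jE kE.
by split; apply: (embedding_twins ge (A := predT)); rewrite ?iE ?jE ?kE.
Qed.

(* In 1243 and 4312 the entries a, b, c, e are taken from left to right, in the
   reversals 3421 and 2134 from right to left; deleting c then leaves the triple
   adjacency a, b, e. *)
Definition interval1243 (p : permutation) : Prop :=
  exists a b c e : 'I_(plength p), uniq [:: a; b; c; e] /\
    twins predT a b /\ twins predT c e /\ twins (predC1 c) b e.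

Lemma mobius_interval1243 s p :
  adjacency_free s -> interval1243 p -> mobius s p = 0%R.
Proof.
move=> sf; have [n] := ubnP (plength p); elim: n p => // n IH p pn.
move=> [a [b [c [e [u [ab [ce be]]]]]]].
have [anb anc ane bnc bne] : [/\ a != b, a != c, a != e, b != c & b != e].
  by move: u; rewrite /= !inE !negb_or => /and4P[/and3P[-> -> ->] /andP[-> ->]].
have cne : c != e by move: u; rewrite /= !inE => /and4P[].
apply: (mobius_eq0_deletion (b := b) (x := c) (y := e)) => //.
- exact: twins_adjacency anb ab.
- by rewrite eq_sym.
- by rewrite eq_sym.
- exact: twins_sub ce.
move=> t tp.
have tn : plength t < n by apply: leq_trans (lt_plength tp) _.
have [g ge] : exists g, @embedding t p g by exact/containedP/(ltW tp).
(* This is used twice: for [g] itself if it misses [c], and for the result of replacing [c] by [e]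
   if [g] misses [e]. *)
have avoid_c h : @embedding t p h -> (forall i, h i \in ~: [set c]) ->
    mobius s t = 0%R \/
    exists g, @embedding t p g /\ forall i, g i \in ~: [set b].
  move=> he hc.
  have sub x : (forall i, h i \in ~: [set x]) ->
      forall i, h i \in ~: [set c; x].
    by move=> hx i; have := (hc i, hx i); rewrite !inE negb_or => -[-> ->].
  have [[j jE]|hA] := embedding_hits h b; last by right; exists h.
  have [[i iE]|/sub hA] := embedding_hits h a; last first.
    right; have [||k [ke kA]] := embedding_swap (x := b) (y := a) he hA.
    - by rewrite !inE eqxx orbT.
    - exact: twins_sub (twins_sym ab).
    exists k; split=> // l; have := kA l.
    by rewrite !inE => /orP[/eqP -> //|/andP[]].
  have [[k kE]|/sub hA] := embedding_hits h e; last first.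
    right; have [||k [ke kA]] := embedding_swap (x := b) (y := e) he hA.
    - by rewrite !inE eqxx orbT.
    (* The entries [b] and [e] are twins only outside [c], so this swap relies on [h] avoiding
       [c]. *)
    - by apply: twins_sub be => x; rewrite !inE negb_or => /andP[].
    exists k; split=> // l; have := kA l.
    by rewrite !inE => /orP[/eqP ->|/andP[] //]; rewrite eq_sym.
  left; apply: mobius_triple_adjacency => //; exists i, j, k; split.
    apply: (@map_uniq _ _ h).
    by rewrite /= iE jE kE !inE negb_or anb ane bne.
  split; first by apply: (embedding_twins he (A := predT)); rewrite ?iE ?jE.
  apply: (embedding_twins he (A := predC1 c)); last by rewrite jE kE.
  by move=> l _; have := hc l; rewrite !inE.
have [[j jE]|gA] := embedding_hits g b; last by right; exists g.
have [[i iE]|gA] := embedding_hits g a; last first.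
  right; have [||h [he hA]] := embedding_swap (x := b) (y := a) ge gA.
  - by rewrite !inE eqxx.
  - exact: twins_sub (twins_sym ab).
  exists h; split=> // k; have := hA k.
  by rewrite !inE => /orP[/eqP -> //|/andP[]].
have [[k kE]|gA] := embedding_hits g c; last exact: avoid_c gA.
have [[l lE]|gA] := embedding_hits g e; last first.
  have [||h [he hA]] := embedding_swap (x := c) (y := e) ge gA.
  - by rewrite !inE eqxx.
  - exact: twins_sub ce.
  apply: (avoid_c h he) => m; have := hA m.
  by rewrite !inE => /orP[/eqP ->|/andP[] //]; rewrite eq_sym.
left; apply: IH => //; exists i, j, k, l; split.
  by apply: (@map_uniq _ _ g); rewrite /= iE jE kE lE.
split; first by apply: (embedding_twins ge (A := predT)); rewrite ?iE ?jE.
split; first by apply: (embedding_twins ge (A := predT)); rewrite ?kE ?lE.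
apply: (embedding_twins ge (A := predC1 c)); last by rewrite jE lE.
(* Only [k] is sent to [c], so twins outside [c] pull back to twins outside [k]. *)
by move=> m; rewrite !inE -kE (inj_eq (embedding_inj ge)).
Qed.

(** * From the interval to the twin relations *)

Lemma symmetry1243_interval1243 (alpha : {perm 'I_4}) :
  symmetry perm1243 alpha -> interval1243 (mkp alpha).
Proof.
move=> /symmetry1243P; rewrite !inE => H.
have E (k : 'I_4) : alpha k = (nth 0 (oneline alpha) k).-1 :> nat.
  by rewrite nth_oneline.
pose o k (lt : k < 4) : 'I_(plength (mkp alpha)) := Ordinal lt.
(* The cases are 1243, 2134, 3421 and 4312; the middle two are read from right to left. *)
case/or4P: H => /eqP A; rewrite A in E;
  [ exists (o 0 isT), (o 1 isT), (o 2 isT), (o 3 isT)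
  | exists (o 3 isT), (o 2 isT), (o 1 isT), (o 0 isT)
  | exists (o 3 isT), (o 2 isT), (o 1 isT), (o 0 isT)
  | exists (o 0 isT), (o 1 isT), (o 2 isT), (o 3 isT) ];
  by split=> //; split; [|split]; case=> [[|[|[|[|//]]]] lt] //= *; rewrite !E.
Qed.

(** An entry outside an interval lies on the same side of all its entries, in index and in value; an
    entry inside is compared as in [a]. Hence twins in [a] remain twins in [p]. *)
Lemma has_interval1243 (a p : permutation) :
  has_interval a p -> interval1243 a -> interval1243 p.
Proof.
move=> /existsP[i /existsP[j /andP[/andP[_ pI]]]].
case/existsP: pI => [v /existsP[w /eqP vw]] /existsP[f /andP[fo /eqP fI]].
have fe : embedding f.
  case/andP: fo => /'forall_'forall_implyP H1 /'forall_'forall_eqP H2.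
  by split=> k l; [apply: H1|rewrite H2].
have lift A B k l : @twins a A k l -> (forall m, f m \in B -> m \in A) ->
    @twins p B (f k) (f l).
  move=> t BA z zB zk zl; case: (boolP (z \in [set f m | m : 'I_(plength a)])).
    move=> /imsetP[m _ E]; rewrite E in zB zk zl *.
    rewrite (embedding_lt m k fe) (embedding_lt m l fe) -(proj2 fe m k).
    rewrite -(proj2 fe m l); apply: t; first exact: BA.
      by apply: contraNneq zk => ->.
    by apply: contraNneq zl => ->.
  move=> zN; have fk m : f m \in contiguous i j by rewrite -fI imset_f.
  have pk m : tagged p (f m) \in contiguous v w by rewrite -vw imset_f.
  have pN : tagged p z \notin contiguous v w.
    rewrite -vw; apply: contra zN => /imsetP[z' z'I /perm_inj ->].
    by rewrite fI.
  rewrite fI in zN.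
  by move: zN pN (fk k) (fk l) (pk k) (pk l); rewrite !inE; lia.
move=> [b [c [d [e [u [bc [de ce]]]]]]].
exists (f b), (f c), (f d), (f e); split.
  rewrite -[_ :: _]/(map f [:: b; c; d; e]) map_inj_uniq //.
  exact: embedding_inj fe.
split; first exact: lift bc _.
split; first exact: lift de _.
by apply: lift ce _ => m; rewrite !inE; apply: contraNneq => ->.
Qed.

Theorem theorem2 (sigma pi : permutation) :
  adjacency_free sigma ->
  (exists alpha : {perm 'I_4},
     symmetry perm1243 alpha /\ has_interval (mkp alpha) pi) ->
  mobius sigma pi = 0%R.
Proof.
move=> sf [alpha [/symmetry1243_interval1243 Q /has_interval1243 H]].
exact: mobius_interval1243 sf (H Q).
Qed.
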